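(* Let $(X,d)$ be a geodesic space and let $\Phi:X\to\mathbb R\cup\{+\infty\}$ be a proper geodesically convex functional bounded from below. Let $p,q\in(1,+\infty)$ satisfy $p^{-1}+q^{-1}=1$. Let $u\in X$ and $\varepsilon>0$ be such that $$\Phi(u)\le \inf_{v\in X}\Phi(v)+\varepsilon.$$ Then, for any $\lambda>0$ and any $\hat u\in \operatorname{prox}_{\frac{\lambda^p}{\varepsilon}\Phi}(u)$, the following estimates hold: (a) $d(u,\hat u)\le \lambda$; (b) $\Phi(\hat u)+\dfrac{\lambda^q}{p\,\varepsilon^{q/p}}\,|\partial\Phi|(\hat u)^q\le \Phi(u)$; (c) $|\partial\Phi|(\hat u)\le \dfrac{\varepsilon}{\lambda}$.
   Context: A geodesic space is a metric space $(X,d)$ such that for every $u,v\in X$ there is a constant-speed geodesic $\gamma:[0,1]\to X$ with $\gamma(0)=u$ and $\gamma(1)=v$, where constant-speed geodesic means $d(\gamma(s),\gamma(t))=|s-t|\,d(\gamma(0),\gamma(1))$ for all $s,t\in[0,1]$. Completeness is not assumed. A functional $\Phi:X\to\mathbb R\cup\{+\infty\}$ is proper if it is not identically $+\infty$. It is geodesically convex if for every $u,v\in X$ there is at least one constant-speed geodesic $\gamma:[0,1]\to X$ with $\gamma(0)=u$, $\gamma(1)=v$ and $\Phi(\gamma(t))\le(1-t)\Phi(\gamma(0))+t\Phi(\gamma(1))$ for all $t\in[0,1]$. Lower semicontinuity is not assumed. For a functional $\Psi:X\to\mathbb R\cup\{+\infty\}$, the (set-valued, possibly empty) proximal mapping with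 exponent $p$ is $$\operatorname{prox}_{\Psi}(u):=\operatorname*{arg\,min}_{v\in X}\Big\{\Psi(v)+\frac1p\,d(v,u)^p\Big\}.$$ The metric slope of $\Phi$ at a point $u$ (here only needed where $\Phi(u)<+\infty$) is $$|\partial\Phi|(u):=\max\Big\{\limsup_{v\to u}\frac{\Phi(u)-\Phi(v)}{d(u,v)},\,0\Big\},$$ where the limsup is over $v\ne u$. *)

(* Defs.v *)
From HB Require Import structures.
From mathcomp Require Import all_boot all_order all_algebra.
From mathcomp Require Import all_classical all_reals all_analysis.

Set Implicit Arguments.
Unset Strict Implicit.
Unset Printing Implicit Defensive.

Import Order.TTheory GRing.Theory Num.Theory.
Import numFieldNormedType.Exports.

Local Open Scope classical_set_scope.
Local Open Scope ring_scope.

(* A curve [0, 1] -> X is represented by a function on the whole line R whose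
   values outside [0, 1] are unconstrained. *)
Definition is_constant_speed_geodesic (R : realType) (X : metricType R)
    (g : R -> X) : Prop :=
  forall s t : R, 0 <= s <= 1 -> 0 <= t <= 1 ->
    mdist (g s) (g t) = `|s - t| * mdist (g 0) (g 1).

Definition geodesic_space (R : realType) (X : metricType R) : Prop :=
  forall u v : X, exists g : R -> X,
    [/\ is_constant_speed_geodesic g, g 0 = u & g 1 = v].

Local Open Scope ereal_scope.

(* The functionals X -> R U {+oo} of the theory are functions X -> \bar R that
   never take the value -oo. *)
Definition never_ninfty (R : realType) (X : Type) (Phi : X -> \bar R) : Prop :=
  forall x : X, Phi x != -oo.

Definition proper_functional (R : realType) (X : Type) (Phi : X -> \bar R) :
    Prop :=
  exists x : X, Phi x != +oo.

Definition bounded_from_below (R : realType) (X : Type) (Phi : X -> \bar R) :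
    Prop :=
  exists m : R, forall x : X, m%:E <= Phi x.

(* In \bar R, 0 * +oo = 0; this only matters at t = 0 and t = 1, where the
   inequality holds trivially. *)
Definition geodesically_convex (R : realType) (X : metricType R)
    (Phi : X -> \bar R) : Prop :=
  forall u v : X, exists g : R -> X,
    [/\ is_constant_speed_geodesic g, g 0%R = u, g 1%R = v &
        forall t : R, (0 <= t <= 1)%R ->
          Phi (g t) <= (1 - t)%:E * Phi (g 0%R) + t%:E * Phi (g 1%R)].

Definition argmin (R : realType) (X : Type) (F : X -> \bar R) : set X :=
  [set v | forall w : X, F v <= F w].

Definition prox (R : realType) (X : metricType R) (p : R) (Psi : X -> \bar R)
    (u : X) : set X :=
  argmin (fun v : X => Psi v + (p^-1 * mdist v u `^ p)%:E).

(* u^' is the filter of punctured neighbourhoods of u; when u is isolated the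
   limsup is -oo and the slope is 0. *)
Definition metric_slope (R : realType) (X : metricType R) (Phi : X -> \bar R)
    (u : X) : \bar R :=
  maxe (limf_esup (fun v : X => (Phi u - Phi v) / (mdist u v)%:E) u^') 0.

(* Main.v *)
(** Write [A = lambda^p / eps] and [D = d(uhat, u)]. Minimality of [uhat] and the
    triangle inequality give [|dPhi|(uhat) <= D^(p-1) / A]; inserting this into
    minimality tested at [u] is (b). Convexity enters only in (a): at a point of a
    geodesic from [uhat] to [u] the first-order gain of [d(., u)^p / p] yields
    [a^(p-1) D <= A (Phi u - Phi uhat) <= lambda^p] for every [a < D], and
    [a = lambda] is contradictory if [lambda < D]. (c) combines (a) with the slope
    bound. *)

Require Import Defs.
From HB Require Import structures.
From mathcomp Require Import all_boot all_order all_algebra.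
From mathcomp Require Import all_classical all_reals all_analysis.
From mathcomp Require Import ring lra.

Set Implicit Arguments.
Unset Strict Implicit.
Unset Printing Implicit Defensive.

Import Order.TTheory GRing.Theory Num.Theory.
Import numFieldNormedType.Exports.

Local Open Scope classical_set_scope.
Local Open Scope ereal_scope.
Local Open Scope ring_scope.

(* Young's inequality for [b] and [a^(p-1)]: no derivative is needed. *)
Lemma powR_tangent_le (R : realType) (p a b : R) :
  1 < p -> 0 <= a -> 0 <= b ->
  p * (b - a) * a `^ (p - 1) <= b `^ p - a `^ p.
Proof.
move=> p1 a0 b0.
have p0 : 0 < p by lra.
have pB1 : 0 < p - 1 by lra.
pose q := p / (p - 1).
have q0 : 0 < q by rewrite divr_gt0.
have pq : p^-1 + q^-1 = 1 by rewrite /q; field; rewrite !gt_eqF.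
have := conjugate_powR b0 (powR_ge0 a (p - 1)) p0 q0 pq.
have -> : (a `^ (p - 1)) `^ q = a `^ p.
  by rewrite -powRrM /q mulrCA divff ?mulr1// gt_eqF.
move=> /(ler_wpM2l (ltW p0)).
have -> : p * (b `^ p / p + a `^ p / q) = b `^ p + (p - 1) * a `^ p.
  by rewrite /q; field; rewrite !gt_eqF.
rewrite -(mulr_powRB1 a0 p0); lra.
Qed.

Lemma limf_esup_le (R : realType) (T : choiceType) (X : filteredType T)
    (f : X -> \bar R) (F : set_system X) (c : \bar R) :
  F [set x | (f x <= c)%E] -> (limf_esup f F <= c)%E.
Proof.
move=> Fc; apply: (@le_trans _ _ (ereal_sup (f @` [set x | (f x <= c)%E]))).
  by apply: ereal_inf_lbound; exists [set x | (f x <= c)%E].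
by apply: ge_ereal_sup => _ [x fxc <-].
Qed.

(** Compare with a point where [Phi] is finite: since [0 < A], the value [+oo] at [uhat] would make
    the minimum infinite. *)
Lemma prox_fin_num (R : realType) (X : metricType R) (Phi : X -> \bar R)
    (p A : R) (u uhat : X) :
  never_ninfty Phi -> proper_functional Phi -> 0 < A ->
  prox p (fun v => A%:E * Phi v)%E u uhat -> Phi uhat \is a fin_num.
Proof.
move=> Phi_ny [x Phix] A0 /(_ x); have := Phi_ny x.
case: (Phi x) Phix => // r _ _; have := Phi_ny uhat.
by case: (Phi uhat) => // _; rewrite gt0_muley ?lte_fin// -EFinM -EFinD.
Qed.

Lemma prox_le (R : realType) (X : metricType R) (Phi : X -> \bar R)
    (p A : R) (u uhat v : X) :
  prox p (fun v => A%:E * Phi v)%E u uhat ->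
  Phi uhat \is a fin_num -> Phi v \is a fin_num ->
  A * fine (Phi uhat) + p^-1 * mdist uhat u `^ p <=
  A * fine (Phi v) + p^-1 * mdist v u `^ p.
Proof.
move=> /(_ v) + h1 h2.
by rewrite -{1}(fineK h1) -{1}(fineK h2) -!EFinM -!EFinD lee_fin.
Qed.

(* Minimality is tested at the point at distance [a] from [u] on a geodesic from
   [uhat] to [u] along which [Phi] is convex. *)
Lemma prox_geodesic_le (R : realType) (X : metricType R) (Phi : X -> \bar R)
    (p A a : R) (u uhat : X) :
  never_ninfty Phi -> geodesically_convex Phi -> 1 < p -> 0 < A ->
  prox p (fun v => A%:E * Phi v)%E u uhat ->
  Phi uhat \is a fin_num -> Phi u \is a fin_num ->
  0 <= a -> a < mdist uhat u ->
  mdist uhat u * a `^ (p - 1) <= A * (fine (Phi u) - fine (Phi uhat)).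
Proof.
move=> Phi_ny Phi_cvx p1 A0 uhatP fuh fu a0 aD.
set D := mdist uhat u in aD *.
have D0 : 0 < D by apply: le_lt_trans aD.
have [g [g_geo g0 g1 gcvx]] := Phi_cvx uhat u.
pose t := 1 - a / D.
have aD0 : 0 <= a / D by rewrite divr_ge0// ltW.
have aD1 : a / D < 1 by rewrite ltr_pdivrMr// mul1r.
have t01 : 0 <= t <= 1 by rewrite /t; lra.
have dg : mdist (g t) u = a.
  rewrite -g1 g_geo ?lexx ?ler01// g0 g1 -/D ler0_norm; last by rewrite /t; lra.
  by rewrite /t; field; rewrite gt_eqF.
have := gcvx t t01; rewrite g0 g1 -(fineK fuh) -(fineK fu) -!EFinM -EFinD => gt_le.
have fgt : Phi (g t) \is a fin_num.
  by move: gt_le (Phi_ny (g t)); case: (Phi (g t)).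
move: gt_le; rewrite -(fineK fgt) lee_fin => gt_le.
have := prox_le uhatP fuh fgt; rewrite dg -/D.
have := powR_tangent_le p1 a0 (ltW D0).
move: gt_le => /(ler_wpM2l (ltW A0)).
have p0 : 0 < p by lra.
set P := fine (Phi (g t)); set Pu := fine (Phi u); set Ph := fine (Phi uhat).
set y := a `^ (p - 1); set z := a `^ p; set w := D `^ p => h1 h2 h3.
have h4 : (D - a) * y <= p^-1 * w - p^-1 * z.
  rewrite -mulrBr [leRHS]mulrC ler_pdivlMr//; lra.
(* Both sides carry a factor [t]: the distance term drops by at least [t * D * y], while convexity
   lets [A * Phi] rise by at most [t * A * (Pu - Ph)]. Cancelling [t] gives the claim. *)
have DaE : D - a = t * D by rewrite /t; field; rewrite gt_eqF.
have t0 : 0 < t by rewrite /t; lra.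
rewrite -(ler_pM2l t0) mulrA -DaE /=; lra.
Qed.

(** A competitor at distance [d] from [uhat] lies within [D + d] of [u], so minimality and the
    tangent inequality bound the difference quotient by [(D + d)^(p-1) / A]; then [d] tends to
    [0]. *)
Lemma prox_metric_slope_le (R : realType) (X : metricType R)
    (Phi : X -> \bar R) (p A : R) (u uhat : X) :
  never_ninfty Phi -> 1 < p -> 0 < A ->
  prox p (fun v => A%:E * Phi v)%E u uhat -> Phi uhat \is a fin_num ->
  (metric_slope Phi uhat <= (mdist uhat u `^ (p - 1) / A)%:E)%E.
Proof.
move=> Phi_ny p1 A0 uhatP fuh; set D := mdist uhat u.
have D0 : 0 <= D by apply: mdist_ge0.
have p0 : 0 < p by lra.
have pB1 : 0 < p - 1 by lra.
(* The bound is first proved with slack, on the punctured ball of radius [K - D]. *)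
have slopeK K : D < K -> (metric_slope Phi uhat <= (K `^ (p - 1) / A)%:E)%E.
  move=> DK; have K0 : 0 <= K by lra.
  rewrite /metric_slope ge_max lee_fin divr_ge0 ?powR_ge0 ?(ltW A0)// andbT.
  apply: limf_esup_le.
  have KD0 : 0 < K - D by lra.
  have := nbhsx_ballx uhat _ KD0; rewrite ballEmdist => near_uhat.
  apply: filterS near_uhat => v /= dlt vuhat.
  have d0 : 0 < mdist uhat v by rewrite mdist_gt0 eq_sym.
  rewrite inver gt_eqF//; set d := mdist uhat v in dlt d0 *.
  (* Where [Phi v = +oo] the quotient is [-oo]. *)
  have [fv|] := boolP (Phi v \is a fin_num); last first.
    move: (Phi_ny v) fuh; case: (Phi v) => // _; case: (Phi uhat) => // r _ _.
    by rewrite /= gt0_mulNye ?leNye// lte_fin invr_gt0.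
  rewrite -(fineK fuh) -(fineK fv) -EFinB -EFinM lee_fin ler_pdivrMr//.
  rewrite mulrAC ler_pdivlMr//.
  have Dd0 : 0 <= D + d by lra.
  have hle := prox_le uhatP fuh fv.
  have dvu : mdist v u `^ p <= (D + d) `^ p.
    apply: ge0_ler_powR; rewrite ?nnegrE ?mdist_ge0 ?(ltW p0)//.
    by rewrite addrC /d /D (metric_sym uhat v) metric_triangle.
  have DdK : (D + d) `^ (p - 1) <= K `^ (p - 1).
    by apply: ge0_ler_powR; rewrite ?nnegrE ?(ltW pB1)//; lra.
  (* The tangent is taken at the larger point [D + d], which bounds the increment of the power from
     above. *)
  have tan := powR_tangent_le p1 Dd0 D0.
  have h4 : p^-1 * (D + d) `^ p - p^-1 * D `^ p <= d * (D + d) `^ (p - 1).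
    rewrite -mulrBr mulrC ler_pdivrMr//; lra.
  move: dvu => /(ler_wpM2l (ltW (divr_gt0 ltr01 p0))); rewrite div1r => dvu.
  have h5 := ler_wpM2l (ltW d0) DdK.
  rewrite -/D in hle; lra.
have slope_ge0 : (0 <= metric_slope Phi uhat)%E by rewrite le_max lexx orbT.
(* One choice of [K] already excludes an infinite slope. *)
have := slopeK (D + 1); case: (metric_slope Phi uhat) slope_ge0 slopeK => //; last
  by rewrite ltrDl ltr01 => _ _ /(_ isT).
move=> s; rewrite lee_fin => s0 slopeK _; rewrite lee_fin ler_pdivlMr//.
have sA0 : 0 <= s * A by rewrite mulr_ge0// ltW.
(* Inverting the power makes the bound linear in [K = D + e], so letting [e] tend to [0] needs no
   continuity of the power. *)
suff : (s * A) `^ (p - 1)^-1 <= D.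
  move=> /(ge0_ler_powR (ltW pB1)); rewrite !nnegrE powR_ge0 D0 => /(_ isT isT).
  by rewrite -powRrM mulVf ?gt_eqF// powRr1.
apply/ler_addgt0Pr => e e0; have De0 : 0 <= D + e by lra.
have := slopeK (D + e); rewrite ltrDl lee_fin ler_pdivlMr// => /(_ e0).
have pVge0 : 0 <= (p - 1)^-1 by rewrite invr_ge0 ltW.
move=> /(ge0_ler_powR pVge0); rewrite !nnegrE powR_ge0 sA0 => /(_ isT isT).
by rewrite -powRrM divff ?gt_eqF// powRr1.
Qed.

Theorem theorem1p7 (R : realType) (X : metricType R) (Phi : X -> \bar R)
    (p q eps : R) (u : X) :
  geodesic_space X ->
  never_ninfty Phi ->
  proper_functional Phi ->
  geodesically_convex Phi ->
  bounded_from_below Phi ->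
  1 < p -> 1 < q -> p^-1 + q^-1 = 1 ->
  0 < eps ->
  (Phi u <= ereal_inf (range Phi) + eps%:E)%E ->
  forall (lambda : R) (uhat : X),
    0 < lambda ->
    prox p (fun v => (lambda `^ p / eps)%:E * Phi v)%E u uhat ->
    [/\ mdist u uhat <= lambda,
        (Phi uhat + (lambda `^ q / (p * eps `^ (q / p)))%:E
                    * metric_slope Phi uhat `^ q <= Phi u)%E &
        (metric_slope Phi uhat <= (eps / lambda)%:E)%E].
Proof.
move=> _ Phi_ny Phi_proper Phi_cvx _ p1 q1 pq eps0 u_eps lambda uhat l0 uhatP.
set A := lambda `^ p / eps in uhatP.
have p0 : 0 < p by lra.
have q0 : 0 < q by lra.
have pB1 : 0 < p - 1 by lra.
have A0 : 0 < A by rewrite divr_gt0// powR_gt0.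
have fuh := prox_fin_num Phi_ny Phi_proper A0 uhatP.
have u_uhat : (Phi u <= Phi uhat + eps%:E)%E.
  by apply: (le_trans u_eps); rewrite leeD2r//; apply: ereal_inf_lbound; exists uhat.
have fu : Phi u \is a fin_num.
  by move: u_uhat (Phi_ny u); rewrite -(fineK fuh) -EFinD; case: (Phi u).
have lpB1 : lambda `^ p = lambda * lambda `^ (p - 1) by rewrite mulr_powRB1// ltW.
have lpB1_gt0 : 0 < lambda `^ (p - 1) by rewrite powR_gt0.
set D := mdist uhat u.
have D0 : 0 <= D by apply: mdist_ge0.
have Dl : D <= lambda.
  rewrite leNgt; apply/negP => lD.
  have := prox_geodesic_le Phi_ny Phi_cvx p1 A0 uhatP fuh fu (ltW l0) lD.
  have : A * (fine (Phi u) - fine (Phi uhat)) <= A * eps.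
    rewrite ler_pM2l// lerBlDl -lee_fin EFinD !fineK//.
  (* Since [A * eps = lambda^p], cancelling [lambda^(p-1)] leaves [D <= lambda]. *)
  rewrite /A divfK ?gt_eqF// lpB1 => h1 h2; have := le_trans h2 h1.
  by rewrite ler_pM2r// leNgt lD.
have slope := prox_metric_slope_le Phi_ny p1 A0 uhatP fuh.
rewrite -/D in slope.
have slope_ge0 : (0 <= metric_slope Phi uhat)%E by rewrite le_max lexx orbT.
split; first by rewrite metric_sym.
- move: slope slope_ge0; case: (metric_slope Phi uhat) => // s.
  rewrite !lee_fin => slope s0.
  have := prox_le uhatP fuh fu; rewrite mdistxx (powR0 (lt0r_neq0 p0)) mulr0 addr0 -/D.
  rewrite poweR_EFin -(fineK fuh) -(fineK fu) -EFinM -EFinD lee_fin => hmin.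
  have qE : q = p / (p - 1).
    have qV : q^-1 = (p - 1) / p by rewrite -[LHS](addKr p^-1) pq; field; rewrite gt_eqF.
    by rewrite -[q]invrK qV invf_div.
  (* This is the [q]-th power of the slope bound, as [(p - 1) * q = p]. *)
  have sq : s `^ q <= D `^ p / A `^ q.
    have := ge0_ler_powR (ltW q0) _ _ slope; rewrite !nnegrE s0.
    rewrite divr_ge0 ?powR_ge0 ?(ltW A0)// => /(_ isT isT).
    rewrite powRM ?powR_ge0 ?invr_ge0 ?(ltW A0)//.
    rewrite -powRrM qE mulrCA divff ?mulr1 ?gt_eqF// => /le_trans; apply.
    by rewrite -(powR_inv1 (ltW A0)) powRAC powR_inv1 ?powR_ge0.
  (* The exponents collapse: [lambda^q / (eps^(q/p) A^q) = A^-1]. *)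
  have cE : lambda `^ q / (p * eps `^ (q / p)) * (D `^ p / A `^ q)
      = p^-1 * D `^ p / A.
    have -> : A `^ q = lambda `^ p * lambda `^ q / (eps * eps `^ (q / p)).
      have l0' := ltW l0; have e0' := ltW eps0.
      rewrite /A powRM ?powR_ge0 ?invr_ge0// -powRrM.
      rewrite -(powR_inv1 e0') powRAC powR_inv1 ?powR_ge0//.
      (* Conjugacy enters twice: [p * q = p + q] splits the power of [lambda], and [1 + q / p = q]
         merges those of [eps]. *)
      have -> : p * q = p + q.
        by rewrite qE; field; rewrite gt_eqF.
      rewrite powRD; last by rewrite (gt_eqF l0) implybT.
      congr (_ / _).
      rewrite -{2}(powRr1 e0') -powRD; last by rewrite (gt_eqF eps0) implybT.
      congr (_ `^ _).
      by rewrite qE; field; rewrite !gt_eqF.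
    by rewrite /A; field; rewrite !gt_eqF ?powR_gt0.
  apply: (@le_trans _ _ (fine (Phi uhat) + p^-1 * D `^ p / A)).
    rewrite lerD2l -cE; apply: ler_wpM2l => //.
    by rewrite divr_ge0 ?mulr_ge0 ?powR_ge0 ?(ltW p0).
  (* Multiplied by [A], the goal is [hmin], minimality tested at [u]. *)
  rewrite -(ler_pM2l A0) mulrDr [A * (_ / _)]mulrC divfK ?gt_eqF//.
- apply: (le_trans slope); rewrite lee_fin /A invf_div lpB1.
  (* As [eps / lambda = lambda^(p-1) / A], only [D^(p-1) <= lambda^(p-1)] remains. *)
  have -> : eps / lambda = lambda `^ (p - 1) * (eps / (lambda * lambda `^ (p - 1))).
    by field; rewrite !gt_eqF.
  apply: ler_wpM2r.
    by rewrite divr_ge0 ?mulr_ge0 ?powR_ge0// ltW.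
  by apply: ge0_ler_powR; rewrite ?nnegrE// ?ltW.
Qed.
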